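(* Let $M\in\mathrm{M}_n(\mathbb{K})$ be a cyclic matrix with minimal polynomial $f=f_1^{m_1}\cdots f_s^{m_s}$, where $f_1,\dots,f_s\in\mathbb{K}[x]$ are pairwise distinct monic irreducible polynomials and $m_i\ge1$. Let $g\in\mathbb{L}[x]$ be a monic divisor of $f$ of degree $n-k$ with $k\ge1$, and write $g=g_1\cdots g_s$ with $g_i$ a monic divisor of $f_i^{m_i}$ in $\mathbb{L}[x]$. Set $d_i=m_i\deg f_i$, $k_i=m_i\deg f_i-\deg g_i$, $\Lambda=\{i : g_i\neq f_i^{m_i}\}$, and for $i\in\Lambda$ let $\mathcal{C}_i\subseteq\mathbb{L}^{d_i}$ be the $f_i^{m_i}$-polynomial code with generator polynomial $g_i$. Then for all $r\in\{1,\dots,k\}$, $$M_r(\mathcal{C}_g)=\min_{\substack{\sum_{i\in\Lambda}r_i=r\\ r_i\in\{0,\dots,k_i\}}}\sum_{i\in\Lambda}M_{r_i}(\mathcal{C}_i)\le\min_{\substack{\sum_{i\in\Lambda}r_i=r\\ r_i\in\{0,\dots,k_i\}}}\Big(\sum_{i\in\Lambda,\ r_i\neq0}\deg g_i\Big)+r,$$ and $M_{r_i}(\mathcal{C}_i)\le\deg(g_i)+r_i$ for all $i\in\Lambda$, $r_i\in\{1,\dots,k_i\}$. In particular $M_1(\mathcal{C}_g)=\min_{i\in\Lambda}M_1(\mathcal{C}_i)\le\min_{i\in\Lambda}\deg(g_i)+1$ and $M_k(\mathcal{C}_g)=\sum_{i\in\Lambda}M_{k_i}(\mathcal{C}_i)\le\sum_{i\in\Lambda}m_i\deg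 f_i$.
   Context: Let $\mathbb{L}/\mathbb{K}$ be a field extension of finite degree $m\ge n$. Vectors are row vectors. For $c=(c_1,\dots,c_d)\in\mathbb{L}^d$, $\mathrm{Rsupp}(c)$ is the $\mathbb{K}$-row space of the $m\times d$ matrix over $\mathbb{K}$ whose $j$-th column is the coordinate vector of $c_j$ in a fixed $\mathbb{K}$-basis of $\mathbb{L}$, $\mathrm{wt}_R(c)=\dim_{\mathbb{K}}\mathrm{Rsupp}(c)$; for an $\mathbb{L}$-subspace $\mathcal{D}$, $\mathrm{wt}_R(\mathcal{D})$ is the $\mathbb{K}$-dimension of the span of all $\mathrm{Rsupp}(d)$, $d\in\mathcal{D}$. For a $k$-dimensional $\mathbb{L}$-subspace (code) $\mathcal{C}$ and $1\le r\le k$, $M_r(\mathcal{C})=\min\{\mathrm{wt}_R(\mathcal{D}):\mathcal{D}\subseteq\mathcal{C},\dim_{\mathbb{L}}\mathcal{D}=r\}$, and $M_0(\mathcal{C})=0$. A matrix $M\in\mathrm{M}_n(\mathbb{K})$ is cyclic if there is $v\in\mathbb{K}^n$ (a cyclic vector) with $(v,vM^t,\dots,v(M^t)^{n-1})$ a basis; equivalently its minimal polynomial $f$ has degree $n$. For such $M$ and a monic divisor $g$ of $f$ in $\mathbb{L}[x]$, $\mathcal{C}_g=\{v\,g(M)^tP(M)^t : P\in\mathbb{L}[x]\}\subseteq\mathbb{L}^n$; it does not depend on the cyclic vector $v\in\mathbb{K}^n$, has dimension $n-\deg g$, and every $\mathbb{L}$-subspace of $\mathbb{L}^n$ stable under $c\mapsto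 cM^t$ (an $M$-cyclic code) equals $\mathcal{C}_g$ for a unique such $g$, its generator polynomial. For monic $\Theta=x^d+a_{d-1}x^{d-1}+\dots+a_0\in\mathbb{K}[x]$, the companion matrix $C_\Theta$ has ones on the subdiagonal, last column $(-a_0,\dots,-a_{d-1})^t$, zeros elsewhere; the $\Theta$-polynomial code with generator polynomial $g\mid\Theta$ is $\mathcal{C}_g$ for $M=C_\Theta$ (equivalently, the coefficient vectors in $\mathbb{L}^d$ of the degree-$<d$ representatives of the ideal $(\bar g)\subseteq\mathbb{L}[x]/(\Theta)$). *)

(* Defs.v *)
From HB Require Import structures.
From mathcomp Require Import all_boot all_order all_algebra all_field.
From mathcomp Require Import boolp.
Set Implicit Arguments.
Unset Strict Implicit.
Unset Printing Implicit Defensive.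
Import GRing.Theory.
Local Open Scope ring_scope.

(* minimum of F over the (nonempty) finite set {x | P x}; the neutral element
   is the maximum of the same values, so this is the true minimum whenever
   the set is nonempty. *)
Definition minb (T : finType) (P : pred T) (F : T -> nat) : nat :=
  let top := \big[maxn/0%N]_(x | P x) F x in
  \big[minn/top]_(x | P x) F x.

Section RankMetric.
Variables (K : fieldType) (L : fieldExtType K).

Definition inL : K -> L := in_alg L.

Definition coordmx (d : nat) (c : 'rV[L]_d) : 'M[K]_(\dim {:L}, d) :=
  \matrix_(i, j) coord (vbasis {:L}) i (c 0 j).

Definition wtR_vec (d : nat) (c : 'rV[L]_d) : nat := \rank (coordmx c).

Definition rsupp_span_rank (d : nat) (s : seq 'rV[L]_d) : nat :=
  \rank (\sum_(c <- s) <<coordmx c>>)%MS.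

(* wt_R(D): K-dimension of the span of all Rsupp(d), d in D; since K^d is
   finite dimensional, it is the maximum of the dimensions of the spans of the
   Rsupp(d) for d ranging over finite families of elements of D. *)
Definition wtR (d : nat) (D : {vspace 'rV[L]_d}) : nat :=
  \max_(w < d.+1 | `[< exists s : seq 'rV[L]_d,
                        all (fun c => c \in D) s /\ rsupp_span_rank s = w >]) w.

Definition Mr (d : nat) (C : {vspace 'rV[L]_d}) (r : nat) : nat :=
  if r == 0%N then 0%N else
  minb (fun w : 'I_d.+1 => `[< exists D : {vspace 'rV[L]_d},
          [/\ (D <= C)%VS, \dim D = r & wtR D = val w] >]) val.

Definition peval (d : nat) (p : {poly L}) (A : 'M[L]_d) : 'M[L]_d :=
  \sum_(i < size p) p`_i *: A ^+ i.

Definition cyclic_vector (d : nat) (M : 'M[K]_d) (v : 'rV[K]_d) : bool :=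
  row_free (\matrix_(i < d) (v *m (M^T) ^+ i)).

Definition cyclic_mx (d : nat) (M : 'M[K]_d) : Prop :=
  exists v, cyclic_vector M v.

(* C is the M-cyclic code C_g = { v g(M)^t P(M)^t : P in L[x] } for a cyclic
   vector v in K^d (the set does not depend on v). *)
Definition is_code_Cg (d : nat) (M : 'M[K]_d) (g : {poly L})
    (C : {vspace 'rV[L]_d}) : Prop :=
  exists2 v : 'rV[K]_d, cyclic_vector M v &
    forall c : 'rV[L]_d, c \in C <->
      exists P : {poly L},
        c = map_mx inL v *m (peval g (map_mx inL M))^T
                         *m (peval P (map_mx inL M))^T.

(* Companion matrix C_Theta of the paper: ones on the subdiagonal, last
   column (-a_0, ..., -a_{d-1})^t.  MathComp's companionmx is its transpose. *)
Definition companion (Theta : {poly K}) : 'M[K]_((size Theta).-1) :=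
  (companionmx Theta)^T.

Definition is_poly_code (Theta : {poly K}) (g : {poly L})
    (C : {vspace 'rV[L]_((size Theta).-1)}) : Prop :=
  is_code_Cg (companion Theta) g C.

End RankMetric.

(* Main.v *)
(** A cyclic vector [v] of [M] identifies [K[x]/(chi)], [chi] the minimal
    polynomial of [M], with [K^n] through [Q |-> v Q(M)^t], and [C_g] with the
    multiples of [g].  The Chinese remainder theorem is therefore a
    [K]-rational isomorphism [K^n ~ \prod_i K^(d_i)] (the matrices [A i]) that
    carries [C_g] to the product of the codes [C_i] ([i] in Lambda) and of
    zero codes.  For a product of codes, gluing subcodes of the factors gives
    one inequality for [M_r].  For the other, filter a subcode [D] by the
    vanishing of its first components: the graded pieces are subcodes of the
    factors, their dimensions add up to [\dim D], and since the same filtration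
    of the [K]-space Rsupp(D) contains the supports of the pieces, their
    weights add up to at most [wt_R(D)].  The explicit upper bounds are the
    Singleton bound for each [C_i]. *)

Require Import Defs.
From HB Require Import structures.
From mathcomp Require Import all_boot all_order all_algebra all_field.
From mathcomp Require Import boolp.
Set Implicit Arguments.
Unset Strict Implicit.
Unset Printing Implicit Defensive.
Import GRing.Theory.
Local Open Scope ring_scope.

(** * Minima over finite sets *)

Section Minb.
Context {T : finType}.
Implicit Types (P : pred T) (F G : T -> nat).

Lemma minb_le P F x : P x -> (minb P F <= F x)%N.
Proof.
move=> Px; rewrite /minb; move: (\big[maxn/0%N]_(y | P y) F y) => top.
elim: (index_enum T) (mem_index_enum x) => // y r IHr.
rewrite inE big_cons => /predU1P[<-|/IHr le_x]; first by rewrite Px geq_minl.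
by case: ifP => // _; rewrite geq_min le_x orbT.
Qed.

(** The neutral element [top] is a maximum of values of [F], so it respects the bound as soon as one
    value exists. *)
Lemma le_minb P F m :
  (exists x, P x) -> (forall x, P x -> (m <= F x)%N) -> (m <= minb P F)%N.
Proof.
move=> [x0 Px0] mF; rewrite /minb.
elim/big_ind: _ => // [|a b ma mb]; last by rewrite leq_min ma.
by apply: leq_trans (mF _ Px0) _; rewrite (bigD1 x0) //= leq_maxl.
Qed.

Lemma minb_witness P F : (exists x, P x) -> exists2 x, P x & minb P F = F x.
Proof.
move=> [x0 Px0]; have [x Px le_x] := arg_minnP F Px0.
exists x => //; apply/eqP; rewrite eqn_leq minb_le //=.
by apply: le_minb => //; exists x0.
Qed.

Lemma minb_mono P F G : (exists x, P x) -> (forall x, P x -> F x <= G x)%N ->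
  (minb P F <= minb P G)%N.
Proof.
move=> exP FG; apply: le_minb => // x Px.
exact: leq_trans (minb_le F Px) (FG _ Px).
Qed.

End Minb.

(** * Subspaces as row spaces of matrices *)

Section RowSpace.
Context {F : fieldType} {d : nat}.

(** Passing to [<<_>>] gives a square matrix, whose type does not involve [\dim D]. *)
Definition vs_mx (D : {vspace 'rV[F]_d}) : 'M[F]_d :=
  (<<\matrix_(i < \dim D) (vbasis D)`_i>>)%MS.

Definition mx_vs p (X : 'M[F]_(p, d)) : {vspace 'rV[F]_d} :=
  limg (linfun (mulmxr X : 'rV_p -> 'rV_d)).

Lemma mem_vs_mx D c : (c <= vs_mx D)%MS = (c \in D).
Proof.
rewrite /vs_mx genmxE; apply/submxP/idP => [[u ->]|cD].
  rewrite mulmx_sum_row memv_suml // => i _.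
  by rewrite rowK memvZ // vbasis_mem // mem_nth // size_tuple.
exists (\row_i coord (vbasis D) i c).
rewrite mulmx_sum_row [LHS](coord_vbasis cD); apply: eq_bigr => i _.
by rewrite rowK mxE.
Qed.

Lemma mem_mx_vs p (X : 'M[F]_(p, d)) c : (c \in mx_vs X) = (c <= X)%MS.
Proof.
apply/memv_imgP/submxP => [[u _ ->]|[u ->]]; exists u; rewrite ?memvf //.
  by rewrite lfunE.
by rewrite lfunE.
Qed.

Lemma rank_vs_mx D : \rank (vs_mx D) = \dim D.
Proof.
rewrite /vs_mx genmxE; apply/eqP; rewrite -/(row_free _) -kermx_eq0.
apply/rowV0P => u /sub_kermxP; rewrite mulmx_sum_row => u0.
have /freeP fr := basis_free (vbasisP D).
apply/rowP => i; rewrite [RHS]mxE; apply: fr i.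
by rewrite -[RHS]u0; apply: eq_bigr => i _; rewrite rowK.
Qed.

Lemma dim_mx_vs p (X : 'M[F]_(p, d)) : \dim (mx_vs X) = \rank X.
Proof.
rewrite -rank_vs_mx; apply/eqmx_rank/andP.
by split; apply/rV_subP => c; rewrite mem_vs_mx mem_mx_vs.
Qed.

End RowSpace.

(** * Rank supports, rank weights and the generalized weights [Mr] *)

Section Support.
Context {K : fieldType} {L : fieldExtType K}.
Local Notation inL := (@inL K L).

(** The entries of [B] are scalars from [K] and taking coordinates is [K]-linear. *)
Lemma coordmx_mul d e (c : 'rV[L]_d) (B : 'M[K]_(d, e)) :
  coordmx (c *m map_mx inL B) = coordmx c *m B.
Proof.
apply/matrixP => i j; rewrite !mxE linear_sum /=; apply: eq_bigr => k _.
by rewrite !mxE mulrC -scalerAl mul1r linearZ /= mulrC.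
Qed.

Lemma coordmx0 d : coordmx (0 : 'rV[L]_d) = 0.
Proof. by apply/matrixP => i j; rewrite !mxE linear0. Qed.

Lemma coordmx_row d (c : 'rV[L]_d) p (B : 'M[K]_(p, d)) :
  (c <= map_mx inL B)%MS -> (coordmx c <= B)%MS.
Proof. by case/submxP=> u ->; rewrite coordmx_mul submxMl. Qed.

Context {d : nat}.
Implicit Types (D C : {vspace 'rV[L]_d}).

Let span_ranks D (w : 'I_d.+1) := `[< exists s : seq 'rV[L]_d,
  all (fun c => c \in D) s /\ rsupp_span_rank s = w >].

Lemma leq_wtR D (s : seq 'rV[L]_d) : all (fun c => c \in D) s ->
  (rsupp_span_rank s <= wtR D)%N.
Proof.
move=> sD; have rs : (rsupp_span_rank s < d.+1)%N by rewrite ltnS rank_leq_col.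
rewrite -[X in (X <= _)%N]/(val (Ordinal rs)).
by apply: leq_bigmax_cond; apply/asboolP; exists s.
Qed.

(** Some finite family in [D] attains the maximum. Prepending a word [c] of [D] cannot raise its
    rank, so the support of [c] already lies in the span [X]. *)
Lemma wtR_support D : exists2 X : 'M[K]_d, \rank X = wtR D &
  forall c, c \in D -> (coordmx c <= X)%MS.
Proof.
have : (0 < #|span_ranks D|)%N.
  apply/card_gt0P; exists ord0; apply/asboolP; exists [::]; split => //.
  by rewrite /rsupp_span_rank big_nil mxrank0.
case/(eq_bigmax_cond val) => w /asboolP[s [sD sw]] maxw.
exists (\sum_(c <- s) <<coordmx c>>)%MS; first by rewrite /wtR maxw /= -sw.
move=> c cD; have /leq_wtR : all (fun c => c \in D) (c :: s) by rewrite /= cD.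
rewrite /wtR maxw /= -sw /rsupp_span_rank big_cons => le_r.
set X := (\sum_(c <- s) _)%MS in le_r *.
have : (X <= <<coordmx c>> + X)%MS by apply: addsmxSr.
case/mxrank_leqif_sup=> leX; rewrite eqn_leq leX le_r => /esym.
by rewrite addsmx_sub genmxE => /andP[].
Qed.

Lemma wtR_le D p (Y : 'M[K]_(p, d)) :
  (forall c, c \in D -> (coordmx c <= Y)%MS) -> (wtR D <= \rank Y)%N.
Proof.
move=> DY; apply/bigmax_leqP => w /asboolP[s [sD <-]].
rewrite /rsupp_span_rank mxrankS //; elim: s sD => [|c s IHs] /=.
  by rewrite big_nil sub0mx.
by case/andP=> cD sD; rewrite big_cons addsmx_sub genmxE DY // IHs.
Qed.

Lemma wtR_leq_length D : (wtR D <= d)%N.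
Proof.
by rewrite -[leqRHS](@mxrank1 K d); apply: wtR_le => c _; apply: submx1.
Qed.

Lemma Mr_le C D : (D <= C)%VS -> (Mr C (\dim D) <= wtR D)%N.
Proof.
move=> DC; rewrite /Mr; case: eqP => // _.
have wD : (wtR D < d.+1)%N by rewrite ltnS wtR_leq_length.
rewrite -[X in (_ <= X)%N]/(val (Ordinal wD)).
by apply: minb_le; apply/asboolP; exists D.
Qed.

Lemma Mr_witness C r : (r <= \dim C)%N ->
  exists D, [/\ (D <= C)%VS, \dim D = r & wtR D = Mr C r].
Proof.
move=> rC; rewrite /Mr; case: eqP => [->|_].
  exists 0%VS; rewrite sub0v dimv0; split => //.
  apply/eqP; rewrite -leqn0 -[leqRHS](@mxrank0 K d d).
  by apply: wtR_le => c; rewrite memv0 => /eqP ->; rewrite coordmx0 sub0mx.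
set P := (P in minb P); have /(minb_witness val)[w /asboolP[D [DC Dr Dw]] ->] :
    exists w, P w; last by exists D.
(* The first [r] rows of a basis of [C] show that the minimum runs over a nonempty set. *)
pose D := mx_vs (pid_mx r *m row_base (vs_mx C) : 'M_(r, d)).
have DC : (D <= C)%VS.
  apply/subvP => c; rewrite mem_mx_vs -mem_vs_mx => /submx_trans-> //.
  by rewrite (submx_trans (submxMl _ _)) // eq_row_base.
have wD : (wtR D < d.+1)%N by rewrite ltnS wtR_leq_length.
exists (Ordinal wD); apply/asboolP; exists D; split => //.
rewrite dim_mx_vs mxrankMfree ?row_base_free // rank_pid_mx //.
by rewrite rank_vs_mx.
Qed.

Lemma Mr_leq_length C r : (r <= \dim C)%N -> (Mr C r <= d)%N.
Proof. by case/Mr_witness=> D [_ _ <-]; apply: wtR_leq_length. Qed.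

(* Singleton bound: the words of [C] vanishing outside the first
   [d - \dim C + r] coordinates form a space of dimension at least [r]. *)
Lemma Mr_singleton C r : (r <= \dim C)%N -> (Mr C r <= d - \dim C + r)%N.
Proof.
move=> rC; set m := (d - \dim C + r)%N.
have dC : (\dim C <= d)%N by rewrite -rank_vs_mx rank_leq_col.
have md : (m <= d)%N by rewrite /m -leq_subRL ?leq_subr // subKn.
pose Y : 'M[K]_d := pid_mx m.
have rY : \rank Y = m by rewrite rank_pid_mx.
pose D := mx_vs (vs_mx C :&: map_mx inL Y)%MS.
have rD : (r <= \dim D)%N.
  rewrite dim_mx_vs -(leq_add2l (\rank (vs_mx C + map_mx inL Y)%MS)).
  rewrite mxrank_sum_cap rank_vs_mx mxrank_map rY.
  rewrite (leq_trans (leq_add (rank_leq_col _) (leqnn _))) //.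
  by rewrite /m addnA subnKC.
(* [D] may be too large; any subspace of it of dimension exactly [r] still has its support in the
   row space of [Y]. *)
have [E [ED <- wE]] := Mr_witness rD.
have EC : (E <= C)%VS.
  apply: subv_trans ED _; apply/subvP => c.
  by rewrite mem_mx_vs sub_capmx -mem_vs_mx => /andP[].
apply: leq_trans (Mr_le EC) _; rewrite -rY; apply: wtR_le => c /(subvP ED).
by rewrite mem_mx_vs sub_capmx => /andP[_ /coordmx_row->].
Qed.

End Support.

(** * Filtration of a row space by vanishing of the first components *)

Section Filtration.
Context {F : fieldType} {n s : nat} {d : 'I_s -> nat}.
Variable A : forall i, 'M[F]_(n, d i).

Definition filtration p (W : 'M[F]_(p, n)) (t : nat) : 'M[F]_n :=
  (W :&: \bigcap_(i < s | (i < t)%N) kermx (A i))%MS.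

Lemma sub_filtrationP p (W : 'M[F]_(p, n)) t (c : 'rV[F]_n) :
  reflect ((c <= W)%MS /\ forall i : 'I_s, (i < t)%N -> c *m A i = 0)
          (c <= filtration W t)%MS.
Proof.
rewrite sub_capmx; apply: (iffP andP) => -[cW cA]; split => //.
  by move=> i it; apply/sub_kermxP; move/sub_bigcapmxP: cA; apply.
by apply/sub_bigcapmxP => i it; apply/sub_kermxP/cA.
Qed.

(** On step [t] of the filtration the kernel of [A t] is step [t.+1]. By rank-nullity the ranks
    telescope from [W] to step [s], which is zero by joint injectivity. *)
Lemma rank_filtration p (W : 'M[F]_(p, n)) :
  (forall c : 'rV[F]_n, (forall i, c *m A i = 0) -> c = 0) ->
  (\sum_(i < s) \rank (filtration W i *m A i) = \rank W)%N.
Proof.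
move=> injA; pose G (i : nat) := filtration W i.
have -> : \rank W = (\rank (G s) + \sum_(i < s) \rank (G i *m A i))%N.
  suff H t : (t <= s)%N -> \rank W =
      (\rank (G t) + \sum_(i < s | (i < t)%N) \rank (G i *m A i))%N.
    by rewrite (H s) //; congr addn; apply: eq_bigl => i; rewrite ltn_ord.
  elim: t => [_|t IHt ts].
    rewrite big_pred0 // addn0 /G /filtration big_pred0 //.
    by apply: eqmx_rank; apply/andP; rewrite capmxSl sub_capmx submx_refl submx1.
  rewrite (IHt (ltnW ts)) [in RHS](bigD1 (Ordinal ts)) //= addnA.
  congr addn; last by apply: eq_bigl => i; rewrite ltnS ltn_neqAle andbC.
  rewrite -(mxrank_mul_ker (G t) (A (Ordinal ts))) addnC; congr addn.
  apply: eqmx_rank; apply/andP; split; apply/rV_subP => c.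
    rewrite sub_capmx => /andP[/sub_filtrationP[cW c0] /sub_kermxP c0'].
    apply/sub_filtrationP; split => // i.
    rewrite ltnS leq_eqVlt => /predU1P[it|/c0//].
    by rewrite (_ : i = Ordinal ts) //; apply: val_inj.
  move=> /sub_filtrationP[cW c0]; rewrite sub_capmx; apply/andP; split.
    by apply/sub_filtrationP; split => // i it; rewrite c0 // ltnS ltnW.
  by apply/sub_kermxP/c0.
suff -> : G s = 0 by rewrite mxrank0.
apply/eqP/rowV0P => c /sub_filtrationP[_ c0]; apply: injA => i.
exact: c0.
Qed.

End Filtration.

(** * Generalized weights of a product of codes *)

Section BlockDecomposition.
Context {K : fieldType} {L : fieldExtType K} {n s : nat} {d : 'I_s -> nat}.
Local Notation inL := (@inL K L).
Variables (A : forall i, 'M[K]_(n, d i)) (E : 'M[K]_(\sum_i d i, n)).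
Hypothesis mulAE : \mxrow_i A i *m E = 1%:M.
Hypothesis mulEA : E *m \mxrow_i A i = 1%:M.
Variables (C : {vspace 'rV[L]_n}) (Ci : forall i, {vspace 'rV[L]_(d i)}).
Hypothesis mem_C :
  forall c, c \in C <-> forall i, c *m map_mx inL (A i) \in Ci i.

(** The morphism [h] is left general because the filtration is used over [L] for words and over [K]
    for supports. *)
Lemma block_inj (F : fieldType) (h : {rmorphism K -> F}) (c : 'rV[F]_n) :
  (forall i, c *m map_mx h (A i) = 0) -> c = 0.
Proof.
move=> c0; rewrite -(mulmx1 c) -(map_mx1 h) -mulAE map_mxM mulmxA.
suff -> : map_mx h (\mxrow_i A i) = \mxrow_i map_mx h (A i).
  rewrite mul_mxrow; under eq_mxrow do rewrite c0.
  by rewrite mxrow0 mul0mx.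
by apply/matrixP => i j; rewrite !mxE.
Qed.

Lemma glue_subspaces (D : forall i, {vspace 'rV[L]_(d i)}) :
  (forall i, (D i <= Ci i)%VS) ->
  exists D' : {vspace 'rV[L]_n}, [/\ (D' <= C)%VS,
    \dim D' = (\sum_i \dim (D i))%N & (wtR D' <= \sum_i wtR (D i))%N].
Proof.
move=> DC; have map_row : map_mx inL (\mxrow_i A i) = \mxrow_i map_mx inL (A i).
  by apply/matrixP => i j; rewrite !mxE.
have freeE : row_free E by apply/row_freeP; exists (\mxrow_i A i).
(* The product of the [D i], carried back to the ambient space by the isomorphism [E]. *)
pose D' := mx_vs (\mxdiag_i vs_mx (D i) *m map_mx inL E).
have memD' c i : c \in D' -> c *m map_mx inL (A i) \in D i.
  rewrite mem_mx_vs => /submxP[u ->].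
  suff -> : u *m (\mxdiag_i vs_mx (D i) *m map_mx inL E) *m map_mx inL (A i)
       = submxrow u i *m vs_mx (D i) by rewrite -mem_vs_mx submxMl.
  transitivity (submxrow (u *m (\mxdiag_i vs_mx (D i) *m map_mx inL E)
                 *m map_mx inL (\mxrow_i A i)) i).
    by rewrite map_row mul_mxrow mxrowK.
  rewrite -!mulmxA -map_mxM mulEA map_mx1 mulmx1 -[in LHS](submxrowK u).
  by rewrite mul_mxrow_mxdiag mxrowK.
exists D'; split.
- by apply/subvP => c cD; apply/mem_C => i; apply: subvP (DC i) _ (memD' _ _ cD).
- rewrite dim_mx_vs mxrankMfree ?row_free_map // rank_mxdiag.
  by apply: eq_bigr => i _; rewrite rank_vs_mx.
have [X rX DX] := fin_all_exists2 (fun i => wtR_support (D i)).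
under eq_bigr do rewrite -rX.
(* The product of the supports [X i], carried back by [E], contains the support of every word of
   [D']; this works because [E] has entries in [K]. *)
rewrite -rank_mxdiag -(mxrankMfree _ freeE); apply: wtR_le => c cD.
rewrite -[c]mulmx1 -(map_mx1 inL) -mulAE map_mxM mulmxA coordmx_mul submxMr //.
rewrite coordmx_mul mul_mxrow.
have /fin_all_exists[Z coordZ] i : exists Z, coordmx c *m A i = Z *m X i.
  by rewrite -coordmx_mul; apply/submxP/DX/memD'.
under eq_mxrow do rewrite coordZ.
by rewrite -mul_mxrow_mxdiag submxMl.
Qed.

(* [D i] is the image under [A i] of the words of [D] vanishing under
   [A j] for all [j < i]; the same filtration of the support of [D] bounds
   the weights. *)
Lemma split_subspace (D : {vspace 'rV[L]_n}) : (D <= C)%VS ->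
  exists D' : forall i, {vspace 'rV[L]_(d i)},
    [/\ forall i, (D' i <= Ci i)%VS, (\sum_i \dim (D' i) = \dim D)%N &
        (\sum_i wtR (D' i) <= wtR D)%N].
Proof.
move=> DC; pose AL i := map_mx inL (A i).
exists (fun i : 'I_s => mx_vs (filtration AL (vs_mx D) i *m AL i)); split.
- move=> i; apply/subvP => c; rewrite mem_mx_vs => /submxP[u ->].
  have /sub_filtrationP[uD _] := submxMl u (filtration AL (vs_mx D) i).
  by rewrite mulmxA; rewrite mem_vs_mx in uD; move/(subvP DC)/mem_C/(_ i): uD.
- under eq_bigr do rewrite dim_mx_vs.
  by rewrite rank_filtration ?rank_vs_mx // => c; apply: (block_inj (h := inL)).
have [X <- DX] := wtR_support D.
rewrite -(rank_filtration (A := A) X); last first.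
  by move=> c c0; apply: (block_inj (h := idfun)) => i; rewrite map_mx_id.
apply: leq_sum => i _; apply: wtR_le => c; rewrite mem_mx_vs => /submxP[u ->].
have := submxMl u (filtration AL (vs_mx D) i).
rewrite mulmxA; set c' := u *m _ => /sub_filtrationP[c'D c'0].
(* If [c'] vanishes under [A j], so does its whole support, since [A j] is defined over [K]. Hence
   the support of [c'] lies in step [i] of the filtration of [X]. *)
rewrite coordmx_mul submxMr //; apply/rV_subP => w /submxP[z ->].
apply/sub_filtrationP; split.
  by rewrite (submx_trans (submxMl _ _)) // DX // -mem_vs_mx.
by move=> j ji; rewrite -mulmxA -coordmx_mul c'0 // coordmx0 mulmx0.
Qed.

Lemma Mr_block_le (rho : 'I_s -> nat) : (forall i, rho i <= \dim (Ci i))%N ->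
  (Mr C (\sum_i rho i) <= \sum_i Mr (Ci i) (rho i))%N.
Proof.
move=> rhoC; have [D DP] := fin_all_exists (fun i => Mr_witness (rhoC i)).
have DC i : (D i <= Ci i)%VS by case: (DP i).
have [D' [D'C dimD' wtD']] := glue_subspaces DC.
have dimD i : rho i = \dim (D i) by case: (DP i).
have wtD i : Mr (Ci i) (rho i) = wtR (D i) by case: (DP i).
rewrite (eq_bigr _ (fun i _ => dimD i)) [leqRHS](eq_bigr _ (fun i _ => wtD i)).
by rewrite -dimD' (leq_trans (Mr_le D'C)).
Qed.

Lemma Mr_block_ge r : (r <= \dim C)%N ->
  exists rho : 'I_s -> nat, [/\ forall i, (rho i <= \dim (Ci i))%N,
    (\sum_i rho i)%N = r & (\sum_i Mr (Ci i) (rho i) <= Mr C r)%N].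
Proof.
case/Mr_witness=> D [DC dimD <-].
have [D' [D'C dimD' wtD']] := split_subspace DC.
exists (fun i => \dim (D' i)); split=> [i||]; first exact/dimvS/D'C.
  by rewrite dimD'.
by apply: leq_trans wtD'; apply: leq_sum => i _; apply: Mr_le.
Qed.

End BlockDecomposition.

(** * Polynomials evaluated at matrices *)

Section MatrixEvaluation.
Context {F : fieldType} {d : nat}.
Implicit Types (A N : 'M[F]_d) (p q : {poly F}).

(* [horner_mx] without its restriction to matrices of size [_.+1];
   over [L] it is convertible to [peval]. *)
Definition mxev p A : 'M[F]_d := \sum_(i < size p) p`_i *: A ^+ i.

Lemma mxev_wide m p A : (size p <= m)%N ->
  mxev p A = \sum_(i < m) p`_i *: A ^+ i.
Proof.
move=> pm; rewrite /mxev (big_ord_widen m (fun i => p`_i *: A ^+ i)) // big_mkcond.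
by apply: eq_bigr => i _; case: ltnP => // /(nth_default 0)->; rewrite scale0r.
Qed.

Lemma mxevB p q A : mxev (p - q) A = mxev p A - mxev q A.
Proof.
have [sp sq] := (leq_maxl (size p) (size q), leq_maxr (size p) (size q)).
have spq : (size (p - q)%R <= maxn (size p) (size q))%N.
  by rewrite (leq_trans (size_polyD _ _)) // size_polyN.
rewrite (mxev_wide _ sp) (mxev_wide _ sq) (mxev_wide _ spq) -sumrB.
by apply: eq_bigr => i _; rewrite coefB scalerBl.
Qed.

Lemma tr_mxev p A : (mxev p A)^T = mxev p A^T.
Proof.
rewrite linear_sum; apply: eq_bigr => i _ /=; rewrite linearZ /=; congr (_ *: _).
elim: {i}(i : nat) => [|i IHi]; first by rewrite !expr0 trmx1.
by rewrite exprS exprSr -IHi -!mulmxE trmx_mul.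
Qed.

End MatrixEvaluation.

Lemma mxev_horner (F : fieldType) d (A : 'M[F]_d.+1) p : mxev p A = horner_mx A p.
Proof.
rewrite -[p in RHS]coefK poly_def rmorph_sum /=; apply: eq_bigr => i _.
by rewrite horner_mxZ rmorphXn /= horner_mx_X.
Qed.

Lemma mxevM (F : fieldType) d (A : 'M[F]_d) p q :
  mxev (p * q) A = mxev p A *m mxev q A.
Proof.
case: d A => [A|d A]; first by rewrite [LHS]thinmx0 [RHS]thinmx0.
by rewrite !mxev_horner rmorphM.
Qed.

Lemma mxev_char_poly (F : fieldType) d (A : 'M[F]_d) : mxev (char_poly A) A = 0.
Proof.
case: d A => [A|d A]; first exact: thinmx0.
by rewrite mxev_horner Cayley_Hamilton.
Qed.

Lemma map_mxX (F G : fieldType) (h : {rmorphism F -> G}) d (A : 'M[F]_d) i :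
  map_mx h (A ^+ i) = map_mx h A ^+ i.
Proof. by elim: i => [|i IHi]; rewrite ?map_mx1 // !exprS map_mxM IHi. Qed.

Lemma map_mxev (F G : fieldType) (h : {rmorphism F -> G}) d (A : 'M[F]_d) p :
  map_mx h (mxev p A) = mxev (map_poly h p) (map_mx h A).
Proof.
rewrite /mxev size_map_poly map_mx_sum; apply: eq_bigr => i _.
by rewrite map_mxZ map_mxX coef_map.
Qed.

(** * Krylov matrices and cyclic codes *)

Section Krylov.
Context {F : fieldType}.

(** For [m = d] and [N = M^T], freeness of this matrix is [cyclic_vector M v]. The number of rows is
    free so that coefficient vectors of any length can act on it. *)
Definition krylov m d (v : 'rV[F]_d) (N : 'M[F]_d) : 'M[F]_(m, d) :=
  \matrix_(i < m) (v *m N ^+ i).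

Lemma mul_krylov m d (v : 'rV[F]_d) (N : 'M[F]_d) (u : 'rV[F]_m) :
  u *m krylov m v N = v *m mxev (rVpoly u) N.
Proof.
rewrite mulmx_sum_row (mxev_wide N (size_poly _ _)) mulmx_sumr.
by apply: eq_bigr => i _; rewrite rowK -scalemxAr coef_rVpoly_ord.
Qed.

Context {d : nat} {v : 'rV[F]_d} {N : 'M[F]_d} {chi : {poly F}}.
Hypothesis cyclicN : row_free (krylov d v N).
Hypothesis size_chi : size chi = d.+1.
Hypothesis chiN : mxev chi N = 0.

Lemma krylov_span c : exists Q, c = v *m mxev Q N.
Proof.
exists (rVpoly (c *m invmx (krylov d v N))); rewrite -mul_krylov mulmxKV //.
by rewrite -row_free_unit.
Qed.

(** The remainder modulo [chi] has at most [d] coefficients, so one row of length [d] encodes it for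
    every [N'] annihilated by [chi]. *)
Lemma krylov_mod e (v' : 'rV[F]_e) (N' : 'M[F]_e) Q : mxev chi N' = 0 ->
  v' *m mxev Q N' = poly_rV (Q %% chi) *m krylov d v' N'.
Proof.
move=> chiN'; rewrite mul_krylov poly_rV_K; last first.
  by rewrite -ltnS -size_chi ltn_modp -size_poly_eq0 size_chi.
have -> : Q %% chi = Q - Q %/ chi * chi.
  by rewrite {2}(divp_eq Q chi) addrAC subrr add0r.
by rewrite mxevB mxevM chiN' mulmx0 subr0.
Qed.

Lemma krylov_annihilator Q : v *m mxev Q N = 0 <-> chi %| Q.
Proof.
rewrite krylov_mod //; split => [/eqP|/modp_eq0->]; last by rewrite linear0 mul0mx.
rewrite mulmx_free_eq0 // => /eqP/(congr1 rVpoly).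
rewrite poly_rV_K ?linear0; first by rewrite /dvdp => ->.
by rewrite -ltnS -size_chi ltn_modp -size_poly_eq0 size_chi.
Qed.

(** The equation on the left only determines [Q] modulo [chi], which is harmless for divisibility by
    [g] since [g] divides [chi]. *)
Lemma cyclic_code_mem g Q : g %| chi ->
  (exists P, v *m mxev Q N = v *m mxev g N *m mxev P N) <-> g %| Q.
Proof.
move=> g_chi; split => [[P] eqQ|/dvdpP[P ->]]; last first.
  by exists P; rewrite -mulmxA -mxevM mulrC.
have : v *m mxev (Q - g * P) N = 0.
  by rewrite mxevB mulmxBr eqQ mxevM mulmxA subrr.
move/krylov_annihilator/(dvdp_trans g_chi).
by rewrite dvdp_subl // dvdp_mulr.
Qed.

(** With [chi = h * g], the vectors attached to [g * 'X^j] for [j < deg h] form a basis of [C]. *)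
Lemma dim_cyclic_code g (C : {vspace 'rV[F]_d}) : g %| chi ->
  (forall Q, v *m mxev Q N \in C <-> g %| Q) -> \dim C = (d - (size g).-1)%N.
Proof.
move=> g_chi memC; have /dvdpP[h chiE] := g_chi.
have chi0 : chi != 0 by rewrite -size_poly_eq0 size_chi.
move: (chi0); rewrite chiE mulf_eq0 negb_or => /andP[h0 g0].
set e := (d - _)%N.
have sh : size h = e.+1.
  have := size_chi; rewrite chiE size_mul // (polySpred h0) (polySpred g0).
  by rewrite addSn addnS /= => -[]; rewrite /e => <-; rewrite addnK.
pose B := \matrix_(j < e) (v *m mxev (g * 'X^j) N).
have BE u : u *m B = v *m mxev (g * rVpoly u) N.
  have -> : B = krylov e (v *m mxev g N) N.
    apply/row_matrixP => j; rewrite !rowK mxevM mulmxA; congr (_ *m _).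
    rewrite (mxev_wide (m := j.+1)) ?size_polyXn // (bigD1 ord_max) //=.
    rewrite coefXn eqxx scale1r big1 ?addr0 // => i; rewrite -val_eqE /= => ij.
    by rewrite coefXn (negPf ij) scale0r.
  by rewrite mul_krylov mxevM mulmxA.
have freeB : row_free B.
  rewrite -kermx_eq0; apply/rowV0P => u /sub_kermxP.
  rewrite BE => /krylov_annihilator; rewrite chiE mulrC dvdp_mul2l // => hu.
  rewrite -[u]rVpolyK.
  have [->|u0] := eqVneq (rVpoly u) 0; first exact: linear0.
  have := dvdp_leq u0 hu; rewrite sh => /leq_trans/(_ (size_poly _ _)).
  by rewrite ltnn.
rewrite -(eqP freeB) -rank_vs_mx; apply: eqmx_rank; apply/andP.
split; apply/rV_subP => c; rewrite mem_vs_mx => cC; last first.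
  by case/submxP: cC => u ->; rewrite BE; apply/memC/dvdp_mulr.
have [Q cQ] := krylov_span c; move: cC; rewrite cQ => /memC/dvdpP[P ->].
(* Replacing [P] by its remainder modulo [h] changes [P * g] by a multiple of [h * g = chi]. *)
apply/submxP; exists (poly_rV (P %% h)); rewrite BE poly_rV_K; last first.
  by rewrite -ltnS -sh ltn_modp.
apply/eqP; rewrite -subr_eq0 -mulmxBr -mxevB; apply/eqP/krylov_annihilator.
rewrite [X in _ - X]mulrC -mulrBl chiE dvdp_mul2r //.
by rewrite {1}(divp_eq P h) addrK dvdp_mull.
Qed.

(* The map [v *m mxev Q N |-> v' *m mxev Q N'], well defined when [chi] also
   annihilates [N']. *)
Definition krylov_hom e (v' : 'rV[F]_e) (N' : 'M[F]_e) : 'M[F]_(d, e) :=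
  invmx (krylov d v N) *m krylov d v' N'.

Lemma krylov_homE e (v' : 'rV[F]_e) (N' : 'M[F]_e) Q : mxev chi N' = 0 ->
  v *m mxev Q N *m krylov_hom v' N' = v' *m mxev Q N'.
Proof.
move=> chiN'; rewrite krylov_mod // (krylov_mod v' Q chiN') -!mulmxA mulKVmx //.
by rewrite -row_free_unit.
Qed.

End Krylov.

Lemma map_krylov (F G : fieldType) (h : {rmorphism F -> G}) m d
    (v : 'rV[F]_d) (N : 'M[F]_d) :
  map_mx h (krylov m v N) = krylov m (map_mx h v) (map_mx h N).
Proof. by apply/row_matrixP => i; rewrite -map_row !rowK map_mxM map_mxX. Qed.

(** The homomorphism built over [K] thus also computes over [L], which makes the decomposition
    [K]-rational. *)
Lemma map_krylov_hom (F G : fieldType) (h : {rmorphism F -> G}) d e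
    (v : 'rV[F]_d) (N : 'M[F]_d) (v' : 'rV[F]_e) (N' : 'M[F]_e) :
  map_mx h (krylov_hom (v := v) (N := N) v' N') =
  krylov_hom (v := map_mx h v) (N := map_mx h N) (map_mx h v') (map_mx h N').
Proof. by rewrite map_mxM map_invmx !map_krylov. Qed.

(** * Companion matrices, coprime products and minimal polynomials *)

(** Powers of the companion matrix shift the first basis vector through all the others, so its
    Krylov matrix is the identity. *)
Lemma companionmx_cyclic (F : fieldType) (p : {poly F}) : (0 < (size p).-1)%N ->
  exists v, row_free (krylov (size p).-1 v (companionmx p)).
Proof.
move=> p_gt0; exists (delta_mx 0 (Ordinal p_gt0)).
suff -> : krylov _ (delta_mx 0 (Ordinal p_gt0)) (companionmx p) = 1%:M.
  by rewrite row_free_unit unitmx1.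
apply/row_matrixP => -[i ip]; rewrite rowK rowE mulmx1 /=.
elim: i ip => [|i IHi] ip.
  by rewrite expr0 mulmx1; congr delta_mx; apply: val_inj.
by rewrite exprSr -mulmxE mulmxA (IHi (ltnW ip)) mulmx_delta_companion.
Qed.

Lemma mxev_companionmx (F : fieldType) (p : {poly F}) : p \is monic ->
  mxev p (companionmx p) = 0.
Proof.
by move=> mp; have := mxev_char_poly (companionmx p); rewrite companionmxK.
Qed.

Lemma size_prod_monic (F : fieldType) (I : finType) (p : I -> {poly F}) :
  (forall i, p i \is monic) -> size (\prod_i p i) = (\sum_i (size (p i)).-1).+1.
Proof.
move=> mp; suff: size (\prod_i p i) = (\sum_i (size (p i)).-1).+1 /\
  \prod_i p i \is monic by case.
elim/big_rec2: _ => [|i y q _ [sq mq]]; first by rewrite size_poly1 monic1.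
split; last by rewrite monicMl.
rewrite size_monicM ?monic_neq0 // sq addnS /=.
by rewrite (polySpred (monic_neq0 (mp i))) addSn.
Qed.

Lemma dvdp_prod_coprime (F : fieldType) (I : finType) (p : I -> {poly F}) q :
  (forall i j, i != j -> coprimep (p i) (p j)) ->
  \prod_i p i %| q <-> forall i, p i %| q.
Proof.
move=> co_p; split=> [pq i|pq].
  by apply: dvdp_trans pq; rewrite (bigD1 i) //= dvdp_mulr.
have: uniq (index_enum I) by apply: index_enum_uniq.
elim: (index_enum I) => [|i r IHr] /=; first by rewrite big_nil dvd1p.
case/andP=> ir ur; rewrite big_cons Gauss_dvdp ?pq ?IHr //.
elim: r ir {IHr ur} => [|j r IHr]; first by rewrite big_nil coprimep1.
by rewrite inE negb_or big_cons coprimepMr => /andP[/co_p-> /IHr].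
Qed.

Lemma coprimep_irreducible (F : fieldType) (p q : {poly F}) :
  irreducible_poly p -> irreducible_poly q -> p \is monic -> q \is monic ->
  p != q -> coprimep p q.
Proof.
move=> irr_p irr_q mp mq pq; apply: contraNT pq => co_pq.
rewrite -eqp_monic // (eqp_trans _ (irr_q _ _ (dvdp_gcdr p q))) //.
by rewrite eqp_sym irr_p ?dvdp_gcdl.
Qed.

(** A shorter minimal polynomial would be a nontrivial linear relation between the Krylov rows; the
    characteristic polynomial gives the other bound. *)
Lemma cyclic_mxminpoly_size (F : fieldType) n (M : 'M[F]_n.+1) v :
  row_free (krylov n.+1 v M^T) -> size (mxminpoly M) = n.+2.
Proof.
move=> freeM; apply/eqP; rewrite eqn_leq; apply/andP; split.
  rewrite -(size_char_poly M) dvdp_leq ?mxminpoly_dvd_char //.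
  by rewrite monic_neq0 ?char_poly_monic.
rewrite ltnNge; apply/negP => small.
have : poly_rV (mxminpoly M) *m krylov n.+1 v M^T = 0.
  rewrite mul_krylov poly_rV_K // -tr_mxev mxev_horner mx_root_minpoly.
  by rewrite trmx0 mulmx0.
move/eqP; rewrite mulmx_free_eq0 // => /eqP/(congr1 rVpoly).
rewrite poly_rV_K // linear0 => /eqP.
by rewrite (negPf (monic_neq0 (mxminpoly_monic M))).
Qed.

(** * The Chinese remainder isomorphism in matrix form *)

Section ChineseRemainder.
Context {F : fieldType} {n s : nat} {d : 'I_s -> nat}.
Variables (v : 'rV[F]_n) (N : 'M[F]_n) (Theta : 'I_s -> {poly F}).
Variables (vi : forall i, 'rV[F]_(d i)) (Ni : forall i, 'M[F]_(d i)).
Hypothesis cyclicN : row_free (krylov n v N).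
Hypothesis chiN : mxev (\prod_i Theta i) N = 0.
Hypothesis size_chi : size (\prod_i Theta i) = n.+1.
Hypothesis Theta_monic : forall i, Theta i \is monic.
Hypothesis Theta_coprime : forall i j, i != j -> coprimep (Theta i) (Theta j).
Hypothesis size_Theta : forall i, size (Theta i) = (d i).+1.
Hypothesis cyclicNi : forall i, row_free (krylov (d i) (vi i) (Ni i)).
Hypothesis ThetaNi : forall i, mxev (Theta i) (Ni i) = 0.

Lemma mxev_prod0 i : mxev (\prod_j Theta j) (Ni i) = 0.
Proof. by rewrite (bigD1 i) //= mxevM ThetaNi mul0mx. Qed.

(** A vector killed by every [A i] comes from a [Q] divisible by each [Theta i], hence by their
    coprime product; so the map is injective, and the degrees add up to [n]. *)
Lemma krylov_hom_inverse :
  let A i := krylov_hom (v := v) (N := N) (vi i) (Ni i) in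
  exists E, \mxrow_i A i *m E = 1%:M /\ E *m \mxrow_i A i = 1%:M.
Proof.
move=> A; have freeA : row_free (\mxrow_i A i).
  rewrite -kermx_eq0; apply/rowV0P => c /sub_kermxP.
  have [Q ->] := krylov_span cyclicN c; rewrite mul_mxrow -[0]mxrow0.
  move/eq_mxrowP => c0.
  apply/(krylov_annihilator cyclicN size_chi chiN)/dvdp_prod_coprime => // i.
  apply/(krylov_annihilator (cyclicNi i) (size_Theta i) (ThetaNi i)).
  by rewrite -(krylov_homE cyclicN size_chi chiN) ?c0 // mxev_prod0.
have sum_d : (\sum_i d i)%N = n.
  apply: succn_inj; rewrite -size_chi size_prod_monic //; congr _.+1.
  by apply: eq_bigr => i _; rewrite size_Theta.
(* The two sizes agree only up to [sum_d], so no square inverse is taken: a right and a left inverse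
   are found separately and coincide. *)
have [E AE] := row_freeP freeA; exists E; split => //.
have /row_fullP[B BA] : row_full (\mxrow_i A i).
  by rewrite /row_full (eqP freeA) sum_d.
by rewrite (_ : E = B) // -[B]mulmx1 -AE mulmxA BA mul1mx.
Qed.

End ChineseRemainder.

(** * Cyclic codes as products of polynomial codes *)

Lemma is_code_Cg_mem (K : fieldType) (L : fieldExtType K) d (M : 'M[K]_d)
    (chi : {poly K}) (g : {poly L}) (C : {vspace 'rV[L]_d}) :
  size chi = d.+1 -> mxev chi M^T = 0 -> g %| map_poly (@inL K L) chi ->
  is_code_Cg M g C ->
  exists2 v, row_free (krylov d v M^T) & forall Q : {poly L},
    map_mx (@inL K L) v *m mxev Q (map_mx (@inL K L) M^T) \in C <-> g %| Q.
Proof.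
move=> size_chi chiM g_chi [v cyc_v memC]; exists v => // Q.
have cyc_vL : row_free (krylov d (map_mx (@inL K L) v) (map_mx (@inL K L) M^T)).
  by rewrite -map_krylov row_free_map.
have chiML : mxev (map_poly (@inL K L) chi) (map_mx (@inL K L) M^T) = 0.
  by rewrite -map_mxev chiM map_mx0.
rewrite -(cyclic_code_mem cyc_vL _ chiML) ?size_map_poly // -map_trmx.
by rewrite (memC _); split=> -[P ->]; exists P; rewrite -2!tr_mxev.
Qed.

(** Where [gi i] equals [Theta i] the code [C i] is unconstrained, so the product is formed with
    [C' i], which is the zero code there. Each [A i] is built from a cyclic vector compatible with
    [C' i]. *)
Lemma cyclic_code_blocks (K : fieldType) (L : fieldExtType K) n (M : 'M[K]_n)
    s (Theta : 'I_s -> {poly K}) (g : {poly L}) (gi : 'I_s -> {poly L})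
    (Cg : {vspace 'rV[L]_n})
    (C : forall i, {vspace 'rV[L]_((size (Theta i)).-1)}) :
  size (\prod_i Theta i) = n.+1 -> mxev (\prod_i Theta i) M^T = 0 ->
  (forall i, Theta i \is monic) -> (forall i, 1 < size (Theta i))%N ->
  (forall i j, i != j -> coprimep (Theta i) (Theta j)) ->
  (forall i, gi i %| map_poly (@inL K L) (Theta i)) -> g = \prod_i gi i ->
  is_code_Cg M g Cg ->
  (forall i, gi i != map_poly (@inL K L) (Theta i) ->
     is_poly_code (gi i) (C i)) ->
  exists (A : forall i, 'M[K]_(n, (size (Theta i)).-1)) E
         (C' : forall i, {vspace 'rV[L]_((size (Theta i)).-1)}),
    [/\ \mxrow_i A i *m E = 1%:M, E *m \mxrow_i A i = 1%:M,
        forall c, c \in Cg <-> forall i, c *m map_mx (@inL K L) (A i) \in C' i,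
        \dim Cg = (n - (size g).-1)%N &
        forall i, \dim (C' i) = ((size (Theta i)).-1 - (size (gi i)).-1)%N /\
          (gi i != map_poly (@inL K L) (Theta i) -> C' i = C i)].
Proof.
set h := @inL K L; set phi := map_poly h.
move=> size_chi chiN mTheta gt1 co_Theta gi_dvd gE codeCg codeC.
have size_Theta i : size (Theta i) = (size (Theta i)).-1.+1.
  by rewrite prednK // ltnW.
have ThetaN i : mxev (Theta i) (companionmx (Theta i)) = 0.
  exact: mxev_companionmx.
have ThetaNL i : mxev (phi (Theta i)) (map_mx h (companionmx (Theta i))) = 0.
  by rewrite -map_mxev ThetaN map_mx0.
have co_gi i j : i != j -> coprimep (gi i) (gi j).
  move=> /co_Theta; rewrite -(coprimep_map h).
  by move/(coprimep_dvdl (gi_dvd j))/(coprimep_dvdr (gi_dvd i)).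
have g_dvd : g %| phi (\prod_i Theta i).
  rewrite gE; apply/dvdp_prod_coprime => // i; apply: dvdp_trans (gi_dvd i) _.
  by rewrite /phi rmorph_prod (bigD1 i) //= dvdp_mulr.
have [v cyc_v memCg] := is_code_Cg_mem size_chi chiN g_dvd codeCg.
have ex_w i :
    exists w : 'rV[K]_((size (Theta i)).-1)
               * {vspace 'rV[L]_((size (Theta i)).-1)},
    [/\ row_free (krylov (size (Theta i)).-1 w.1 (companionmx (Theta i))),
        forall Q,
          map_mx h w.1 *m mxev Q (map_mx h (companionmx (Theta i))) \in w.2 <-> gi i %| Q &
        gi i != phi (Theta i) -> w.2 = C i].
  have [giE|/codeC codeCi] := eqVneq (gi i) (phi (Theta i)); last first.
    have [|u cyc_u memCi] := is_code_Cg_mem (size_Theta i) _ (gi_dvd i) codeCi.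
      by rewrite /companion trmxK.
    by rewrite /companion trmxK in cyc_u memCi; exists (u, C i).
  have [|u cyc_u] := companionmx_cyclic (p := Theta i).
    by rewrite -ltnS -size_Theta.
  have cyc_uL : row_free
      (krylov (size (Theta i)).-1 (map_mx h u)
         (map_mx h (companionmx (Theta i)))).
    by rewrite -map_krylov row_free_map.
  (* Here the multiples of [gi i] are exactly the annihilators of [u], so the zero code meets the
     membership criterion. *)
  exists (u, 0%VS); split => //= Q; rewrite giE memv0.
  rewrite -(krylov_annihilator cyc_uL _ (ThetaNL i)) ?size_map_poly //.
  by split=> /eqP.
have [w wP] := fin_all_exists ex_w.
have cyc_w i :
    row_free (krylov (size (Theta i)).-1 (w i).1 (companionmx (Theta i))).
  by case: (wP i).
have [E [AE EA]] := krylov_hom_inverse cyc_v chiN size_chi mTheta co_Theta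
  size_Theta cyc_w ThetaN.
have cyc_vL : row_free (krylov n (map_mx h v) (map_mx h M^T)).
  by rewrite -map_krylov row_free_map.
have chiNL : mxev (phi (\prod_i Theta i)) (map_mx h M^T) = 0.
  by rewrite -map_mxev chiN map_mx0.
have size_chiL : size (phi (\prod_i Theta i)) = n.+1 by rewrite size_map_poly.
eexists _, E, (fun i => (w i).2); split; [exact: AE | exact: EA | | |].
(* With [c] written through [Q], its component under [A i] is given by the same [Q], and
   divisibility by [g] splits over the coprime [gi i]. *)
- move=> c; have [Q ->] := krylov_span cyc_vL c.
  rewrite memCg gE dvdp_prod_coprime //; split=> gQ i.
    rewrite map_krylov_hom (krylov_homE cyc_vL size_chiL chiNL).
      by case: (wP i) => _ ->.
    by rewrite -map_mxev (mxev_prod0 ThetaN) map_mx0.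
  have [_ <- _] := wP i; rewrite -(krylov_homE cyc_vL size_chiL chiNL).
    by rewrite -map_krylov_hom.
  by rewrite -map_mxev (mxev_prod0 ThetaN) map_mx0.
- exact: (dim_cyclic_code cyc_vL size_chiL chiNL).
move=> i; have [_ memi Ci] := wP i; split => //.
apply: (dim_cyclic_code _ _ (ThetaNL i)) => //.
  by rewrite -map_krylov row_free_map.
by rewrite size_map_poly.
Qed.

(** * Generalized weights of a cyclic code from those of its primary components *)

(* The dimension of the ambient space is written n.+1 (k >= 1 forces it
   to be positive; MathComp's mxminpoly needs a square matrix of size _.+1). *)
Theorem theorem4 (K : fieldType) (L : fieldExtType K) (n : nat)
  (hnm : (n.+1 <= \dim {:L})%N)
  (M : 'M[K]_n.+1) (hM : cyclic_mx M)
  (s : nat) (f : 'I_s -> {poly K}) (mu : 'I_s -> nat)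
  (hf_monic : forall i, f i \is monic)
  (hf_irr : forall i, irreducible_poly (f i))
  (hf_inj : injective f)
  (hmu : forall i, (0 < mu i)%N)
  (hminpoly : mxminpoly M = \prod_(i < s) f i ^+ mu i)
  (g : {poly L}) (k : nat)
  (hg_monic : g \is monic)
  (hg_div : g %| map_poly (@inL K L) (mxminpoly M))
  (hdeg : ((size g).-1 + k)%N = n.+1) (hk : (0 < k)%N)
  (gi : 'I_s -> {poly L})
  (hgi_monic : forall i, gi i \is monic)
  (hgi_div : forall i, gi i %| map_poly (@inL K L) (f i ^+ mu i))
  (hg_prod : g = \prod_(i < s) gi i)
  (Cg : {vspace 'rV[L]_n.+1}) (hCg : is_code_Cg M g Cg)
  (C : forall i : 'I_s, {vspace 'rV[L]_((size (f i ^+ mu i)).-1)})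
  (hC : forall i, gi i != map_poly (@inL K L) (f i ^+ mu i) ->
          @is_poly_code K L (f i ^+ mu i) (gi i) (C i)) :
  let Lambda := [set i | gi i != map_poly (@inL K L) (f i ^+ mu i)] in
  let ki i := ((size (f i ^+ mu i)).-1 - (size (gi i)).-1)%N in
  let adm r (rho : {ffun 'I_s -> 'I_r.+1}) :=
    [&& (\sum_(i in Lambda) rho i == r)%N,
        [forall i, (i \notin Lambda) ==> (rho i == 0 :> nat)] &
        [forall i, (rho i <= ki i)%N]] in
  (forall r, (1 <= r <= k)%N ->
     Mr Cg r = minb (adm r) (fun rho => (\sum_(i in Lambda) Mr (C i) (rho i))%N)
     /\ (minb (adm r) (fun rho => (\sum_(i in Lambda) Mr (C i) (rho i))%N)
         <= minb (adm r) (fun rho =>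
                 \sum_(i in Lambda | rho i != 0 :> nat) (size (gi i)).-1 + r))%N)
  /\ (forall i, i \in Lambda -> forall ri, (1 <= ri <= ki i)%N ->
        (Mr (C i) ri <= (size (gi i)).-1 + ri)%N)
  /\ Mr Cg 1 = minb [pred i | i \in Lambda] (fun i => Mr (C i) 1)
  /\ (minb [pred i | i \in Lambda] (fun i => Mr (C i) 1)
      <= minb [pred i | i \in Lambda] (fun i => (size (gi i)).-1) + 1)%N
  /\ Mr Cg k = (\sum_(i in Lambda) Mr (C i) (ki i))%N
  /\ (\sum_(i in Lambda) Mr (C i) (ki i)
      <= \sum_(i in Lambda) mu i * (size (f i)).-1)%N.
Proof.
move=> Lambda ki adm; pose Theta i := f i ^+ mu i.
have mTheta i : Theta i \is monic by apply: monic_exp.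
have size_Theta i : (size (Theta i)).-1 = (mu i * (size (f i)).-1)%N.
  by rewrite size_exp mulnC.
have gt1 i : (1 < size (Theta i))%N.
  rewrite -(ltn_predRL 0) size_Theta muln_gt0 hmu -ltnS prednK.
    by case: (hf_irr i).
  by rewrite size_poly_gt0 monic_neq0.
have co_Theta i j : i != j -> coprimep (Theta i) (Theta j).
  move=> ij; apply/coprimep_expl/coprimep_expr/coprimep_irreducible => //.
  by rewrite (inj_eq hf_inj).
have size_chi : size (\prod_i Theta i) = n.+2.
  by case: hM => v /cyclic_mxminpoly_size; rewrite hminpoly.
have chiM : mxev (\prod_i Theta i) M^T = 0.
  by rewrite -hminpoly -tr_mxev mxev_horner mx_root_minpoly trmx0.
have [A [E [C' [AE EA memCg dimCg C'P]]]] :=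
  cyclic_code_blocks size_chi chiM mTheta gt1 co_Theta hgi_div hg_prod hCg hC.
have {}dimCg : \dim Cg = k by rewrite dimCg -hdeg addKn.
have dimC' i : \dim (C' i) = ki i by case: (C'P i).
have C'E i : i \in Lambda -> C' i = C i by rewrite inE; case: (C'P i).
have ki0 i : i \notin Lambda -> ki i = 0%N.
  by rewrite inE negbK /ki => /eqP->; rewrite size_map_poly subnn.
have le_gi i : ((size (gi i)).-1 <= (size (Theta i)).-1)%N.
  rewrite -!subn1 leq_sub2r // -(size_map_poly (@inL K L)) dvdp_leq //.
  by rewrite map_poly_eq0 (monic_neq0 (mTheta i)).
have sum_ki : (\sum_i ki i)%N = k.
  rewrite sumnB => [|i _]; last exact: le_gi.
  apply: succn_inj; rewrite -addn1 -[RHS]addn1 -(addKn (size g).-1 k) hdeg.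
  rewrite hg_prod size_prod_monic //=; congr (_ - _ + 1)%N.
  by apply: succn_inj; rewrite -size_chi size_prod_monic.
have LambdaE (F : 'I_s -> nat) : (forall i, i \notin Lambda -> F i = 0%N) ->
    (\sum_(i in Lambda) F i = \sum_i F i)%N.
  move=> F0; rewrite [RHS](bigID (mem Lambda)) /=.
  by rewrite [X in (_ + X)%N]big1 ?addn0.
(* Off [Lambda] both [ki i] and [rho i] vanish and [Mr _ 0] is zero, so sums over [Lambda] extend to
   all blocks. *)
have MrE (rho : 'I_s -> nat) : (forall i, rho i <= ki i)%N ->
    (\sum_i Mr (C' i) (rho i) = \sum_(i in Lambda) Mr (C i) (rho i))%N.
  move=> rho_ki; rewrite -LambdaE => [|i /ki0 ki_i].
    by apply: eq_bigr => i /C'E->.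
  by move: (rho_ki i); rewrite ki_i leqn0 => /eqP->.
have MrCg_le (rho : 'I_s -> nat) : (forall i, rho i <= ki i)%N ->
    (Mr Cg (\sum_i rho i) <= \sum_(i in Lambda) Mr (C i) (rho i))%N.
  move=> rho_ki; rewrite -MrE //; apply: (Mr_block_le AE EA memCg) => i.
  by rewrite dimC'.
have MrCg_ge r : (r <= k)%N -> exists rho : 'I_s -> nat,
    [/\ forall i, (rho i <= ki i)%N, (\sum_i rho i)%N = r &
        (\sum_(i in Lambda) Mr (C i) (rho i) <= Mr Cg r)%N].
  rewrite -dimCg => /(Mr_block_ge AE memCg)[rho [rho_ki sum_rho]].
  have {}rho_ki i : (rho i <= ki i)%N by rewrite -dimC'.
  by rewrite MrE // => le_rho; exists rho.
have singleton i ri : i \in Lambda -> (ri <= ki i)%N ->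
    (Mr (C i) ri <= (size (gi i)).-1 + ri)%N.
  move=> iL; rewrite -dimC' C'E // => /Mr_singleton/leq_trans; apply.
  by rewrite leq_add2r -C'E // dimC' /ki subKn.
have admP r (rho : {ffun 'I_s -> 'I_r.+1}) : adm r rho ->
    [/\ forall i, (rho i <= ki i)%N & (\sum_i rho i)%N = r].
  case/and3P=> /eqP sum_rho /forallP rho0 /forallP rho_ki; split=> //.
  by rewrite -LambdaE // => i iL; apply/eqP; have /implyP/(_ iL) := rho0 i.
have adm_witness r : (r <= k)%N -> exists2 rho, adm r rho &
    (\sum_(i in Lambda) Mr (C i) (rho i) <= Mr Cg r)%N.
  case/MrCg_ge=> rho [rho_ki sum_rho le_rho].
  (* No part exceeds the total [r], so [rho] fits the finite type over which the minimum is
     taken. *)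
  have rho_r i : (rho i < r.+1)%N.
    by rewrite ltnS -sum_rho (bigD1 i) //= leq_addr.
  exists [ffun i => Ordinal (rho_r i)]; last first.
    by under eq_bigr do rewrite ffunE.
  have rho0 i : i \notin Lambda -> rho i = 0%N.
    by move/ki0=> ki_i; apply/eqP; rewrite -leqn0 -ki_i.
  apply/and3P; split.
  - by under eq_bigr do rewrite ffunE /=; rewrite LambdaE // sum_rho.
  - by apply/forallP => i; apply/implyP => iL; rewrite ffunE /= (rho0 _ iL).
  - by apply/forallP => i; rewrite ffunE /=.
have ex_adm r : (r <= k)%N -> exists rho, adm r rho.
  by case/adm_witness=> rho; exists rho.
(* A monic divisor of full degree equals the polynomial it divides, which [Lambda] excludes. *)
have ki_gt0 i : i \in Lambda -> (0 < ki i)%N.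
  move=> iL; rewrite -dimC' lt0n; apply: contraL iL; rewrite dimC' => ki_i.
  have : size (gi i) == size (map_poly (@inL K L) (Theta i)).
    rewrite eqn_leq dvdp_leq // ?map_poly_eq0 ?monic_neq0 //=.
    rewrite size_map_poly (polySpred (monic_neq0 (hgi_monic i))).
    by rewrite (polySpred (monic_neq0 (mTheta i))) ltnS -subn_eq0.
  rewrite (dvdp_size_eqp (hgi_div i)) eqp_monic //; last first.
    by rewrite map_monic; apply: mTheta.
  by rewrite inE negbK.
have MrCg1 : Mr Cg 1 = minb [pred i | i \in Lambda] (fun i => Mr (C i) 1).
  have [rho [rho_ki sum_rho le_rho]] := MrCg_ge 1%N hk.
  have [i rho_i] : exists i, rho i = 1%N.
    have /existsP[i] : [exists i, rho i != 0%N].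
      apply: contra_eqT sum_rho => /existsPn rho0; rewrite big1 // => i _.
      by apply/eqP; have := rho0 i; rewrite negbK.
    rewrite -lt0n => rho_i; exists i; apply/eqP; rewrite eqn_leq rho_i andbT.
    by rewrite -sum_rho (bigD1 i) //= leq_addr.
  have iL : i \in Lambda.
    by apply: contraLR (rho_ki i) => /ki0->; rewrite rho_i.
  apply/eqP; rewrite eqn_leq; apply/andP; split.
    apply: le_minb => [|j jL]; first by exists i.
    (* The distributions of total 1 are the indicators of a single block. *)
    have sum_j : (\sum_l (l == j : nat))%N = 1%N.
      by rewrite (bigD1 j) //= eqxx big1 // => l /negPf->.
    have -> : Mr (C j) 1 = (\sum_(l in Lambda) Mr (C l) (l == j))%N.
      by rewrite (bigD1 j) //= eqxx big1 ?addn0 // => l /andP[_ /negPf->].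
    rewrite -[X in Mr Cg X]sum_j; apply: MrCg_le => l.
    by case: eqVneq => // ->; apply: ki_gt0.
  apply: leq_trans (minb_le (fun i => Mr (C i) 1) iL) _.
  apply: leq_trans le_rho.
  by rewrite (bigD1 i) //= rho_i leq_addr.
(* For [r = k] only one distribution is left, because the [ki i] already add up to [k]. *)
have rho_le_ki (rho : 'I_s -> nat) : (forall i, rho i <= ki i)%N ->
    (\sum_i rho i)%N = k -> rho =1 ki.
  move=> rho_ki sum_rho i; apply/eqP.
  have /leqif_sum : forall j, true -> (rho j <= ki j ?= iff (rho j == ki j))%N.
    by move=> j _; split.
  by case=> _; rewrite sum_rho sum_ki eqxx => /esym/forallP/(_ i).
have ex_Lambda : exists i, i \in Lambda.
  have [rho [rho_ki sum_rho _]] := MrCg_ge k (leqnn k).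
  apply/existsP; apply: contraTT hk => /existsPn noL; rewrite -sum_ki.
  by rewrite big1 // => i _; apply: ki0.
split; last split; last split; last split; last split.
- move=> r /andP[_ rk]; split.
    apply/eqP; rewrite eqn_leq; apply/andP; split.
      apply: le_minb (ex_adm r rk) _ => rho /admP[rho_ki sum_rho].
      by rewrite -[in X in (X <= _)%N]sum_rho; apply: MrCg_le.
    have [rho adm_rho le_rho] := adm_witness r rk; apply: leq_trans le_rho.
    by rewrite minb_le.
  apply: minb_mono (ex_adm r rk) _ => rho /[dup]/admP[rho_ki sum_rho].
  (* Writing [r] as the sum of the [rho i] allows a termwise comparison: zero parts contribute
     nothing, the others obey the Singleton bound. *)
  case/and3P=> /eqP sumL _ _; rewrite -[X in (_ <= _ + X)%N]sumL.
  rewrite big_mkcondr -big_split; apply: leq_sum => i iL /=.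
  case: eqVneq => [->|_]; first by rewrite addn0.
  exact: singleton.
- by move=> i iL ri /andP[_]; apply: singleton.
- exact: MrCg1.
- have [i iL ->] := minb_witness (fun i => (size (gi i)).-1) ex_Lambda.
  apply: leq_trans (minb_le (fun i => Mr (C i) 1) iL) _.
  by apply: singleton => //; apply: ki_gt0.
- apply/eqP; rewrite eqn_leq -{1}sum_ki MrCg_le //=.
  have [rho [rho_ki sum_rho]] := MrCg_ge k (leqnn k).
  by under eq_bigr do rewrite (rho_le_ki rho rho_ki sum_rho).
apply: leq_sum => i iL; rewrite -size_Theta; apply: Mr_leq_length.
by rewrite -C'E // dimC'.
Qed.
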